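(* Let $D=(V,E)$ be a finite digraph. Then $D$ is an interval nest digraph if and only if there is a linear ordering $<$ of $V$ in which none of the following patterns occurs: (a) vertices $u<v\leq w<z$ with $uz\in E$, $uv\notin E$, $wz\notin E$; (b) vertices $u<v\leq w<z$ with $uz\in E$, $vw\in E$, $uw\notin E$, $vz\notin E$; (c) vertices $u<v<w<z$ with $uw\in E$, $vz\in E$, $uz\notin E$, $vw\notin E$; (d) vertices $u<v\leq w<z$ with $zu\in E$, $vu\notin E$, $zw\notin E$; (e) vertices $u<v\leq w<z$ with $zu\in E$, $wv\in E$, $wu\notin E$, $zv\notin E$; (f) vertices $u<v<w<z$ with $zv\in E$, $wu\in E$, $zu\notin E$, $wv\notin E$; (g) vertices $u<v\leq w<z$ with $uz\in E$, $uv\notin E$, $zw\notin E$; (h) vertices $u<v\leq w<z$ with $zu\in E$, $uv\notin E$, $zw\notin E$; (j) a vertex $u$ with $uu\notin E$.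
   Context: A digraph $D=(V,E)$ consists of a vertex set $V$ and an arc set $E\subseteq V\times V$ (loops allowed, no multiple arcs); $uv$ denotes the arc from $u$ to $v$. $D$ is an interval nest digraph if there is a family $\{I_u,J_u\}_{u\in V}$ of (nonempty, bounded) closed intervals of the real line (single points allowed) such that $J_u\subseteq I_u$ for all $u\in V$ and, for all $u,v\in V$ (not necessarily distinct), $uv\in E$ if and only if $I_u\cap J_v\neq\emptyset$. *)

(* Defs.v *)
From HB Require Import structures.
From mathcomp Require Import all_boot all_order all_algebra.
From mathcomp Require Import classical_sets set_interval reals.

Set Implicit Arguments.
Unset Strict Implicit.
Unset Printing Implicit Defensive.

Import Order.TTheory GRing.Theory Num.Theory.
Local Open Scope classical_set_scope.
Local Open Scope ring_scope.

(* A finite digraph is a finType V with its arc relation E : rel V;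
   loops are allowed, and E u v stands for the arc uv. *)

Definition closed_interval (R : realType) (A : set R) : Prop :=
  exists a b : R, a <= b /\ A = `[a, b]%classic.

Definition interval_nest (R : realType) (V : finType) (E : rel V) : Prop :=
  exists I J : V -> set R,
    [/\ forall u, closed_interval (I u),
        forall u, closed_interval (J u),
        forall u, J u `<=` I u
      & forall u v, E u v <-> I u `&` J v !=set0].

Arguments interval_nest R {V} E.

Definition strict_linear_order (V : finType) (lt : rel V) : Prop :=
  [/\ irreflexive lt, transitive lt
    & forall u v, u != v -> lt u v || lt v u].

Definition weak (V : finType) (lt : rel V) : rel V :=
  fun u v => (u == v) || lt u v.

Definition pattern_a (V : finType) (E lt : rel V) : Prop :=
  exists u v w z, [&& lt u v, weak lt v w, lt w z,
    E u z, ~~ E u v & ~~ E w z].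

Definition pattern_b (V : finType) (E lt : rel V) : Prop :=
  exists u v w z, [&& lt u v, weak lt v w, lt w z,
    E u z, E v w, ~~ E u w & ~~ E v z].

Definition pattern_c (V : finType) (E lt : rel V) : Prop :=
  exists u v w z, [&& lt u v, lt v w, lt w z,
    E u w, E v z, ~~ E u z & ~~ E v w].

Definition pattern_d (V : finType) (E lt : rel V) : Prop :=
  exists u v w z, [&& lt u v, weak lt v w, lt w z,
    E z u, ~~ E v u & ~~ E z w].

Definition pattern_e (V : finType) (E lt : rel V) : Prop :=
  exists u v w z, [&& lt u v, weak lt v w, lt w z,
    E z u, E w v, ~~ E w u & ~~ E z v].

Definition pattern_f (V : finType) (E lt : rel V) : Prop :=
  exists u v w z, [&& lt u v, lt v w, lt w z,
    E z v, E w u, ~~ E z u & ~~ E w v].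

Definition pattern_g (V : finType) (E lt : rel V) : Prop :=
  exists u v w z, [&& lt u v, weak lt v w, lt w z,
    E u z, ~~ E u v & ~~ E z w].

Definition pattern_h (V : finType) (E lt : rel V) : Prop :=
  exists u v w z, [&& lt u v, weak lt v w, lt w z,
    E z u, ~~ E u v & ~~ E z w].

Definition pattern_j (V : finType) (E : rel V) : Prop :=
  exists u, ~~ E u u.

(* Main.v *)
(* Write I_u = [a_u, b_u] and J_u = [c_u, d_u]; nesting means a <= c <= d <= b,
   and uv is an arc iff a_u <= d_v and c_v <= b_u. Given intervals, sorting the
   vertices by any choice of points of the J_u, here c_u, avoids all patterns.
   Conversely, given an ordering, decree c_x <= b_s iff x <= s or sx is an arc,
   and a_x <= d_s iff x <= s or xs is an arc. Avoiding (a), (b), (c) makes the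
   first relation a Ferrers relation, which ranks all the c's and b's linearly;
   (d), (e), (f) do the same for the a's and d's, by order reversal. The two
   rankings are merged by putting q in {c, b} below p in {a, d} exactly when
   q <= c_v and d_w <= p for some v <= w. This forces c_u <= d_u and always gives
   a linear preorder; a_u <= c_u and d_u <= b_u hold by (g) and (h). *)
Require Import Defs.
From HB Require Import structures.
From mathcomp Require Import all_boot all_order all_algebra.
From mathcomp Require Import classical_sets set_interval reals.
From mathcomp Require Import boolp zify lra.

Set Implicit Arguments.
Unset Strict Implicit.
Unset Printing Implicit Defensive.

Import Order.TTheory GRing.Theory Num.Theory.

(** * Strict linear orders and their weak forms *)

Section Order.
Variables (V : finType) (lt : rel V).
Hypothesis lt_slo : strict_linear_order lt.

Lemma strict_linear_order_rev : strict_linear_order (fun x y => lt y x).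
Proof.
case: lt_slo => ltxx lttr lttot; split=> [x|y x z yx zy|x y nxy] //.
  exact: lttr zy yx.
by rewrite orbC; apply: lttot.
Qed.

Lemma weakN x y : ~~ weak lt x y = lt y x.
Proof.
case: lt_slo => ltxx lttr lttot; rewrite /weak; case: eqVneq => [->|nxy] /=.
  by rewrite ltxx.
apply/idP/idP => [nlt|yx]; first by have := lttot _ _ nxy; rewrite (negPf nlt).
by apply/negP => /(lttr _ _ _ yx); rewrite ltxx.
Qed.

Lemma weak_lt_trans y x z : weak lt x y -> lt y z -> lt x z.
Proof. by case: lt_slo => _ lttr _ /orP[/eqP->//|]; apply: lttr. Qed.

Lemma lt_weak_trans y x z : lt x y -> weak lt y z -> lt x z.
Proof. by case: lt_slo => _ lttr _ xy /orP[/eqP<-//|]; apply: lttr. Qed.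

Lemma weak_rev x y : weak (fun x y => lt y x) x y = weak lt y x.
Proof. by rewrite /weak eq_sym. Qed.

End Order.

(** * Ranking a Ferrers relation *)

Section Rank.
Variables (V : finType) (lt M : rel V).
Hypothesis lt_slo : strict_linear_order lt.
Hypothesis ferrers : forall x y s t, M x s -> M y t -> M x t || M y s.

(* The second clause says that ties between left values are broken by lt. *)
Lemma ferrers_rank : exists l r : V -> nat,
  (forall x s, if M x s then l x < r s else r s < l x) /\
  (forall v x, lt v x -> l x <= l v -> exists2 t, M x t & ~~ M v t).
Proof.
case: lt_slo => ltxx lttr _.
(* By the Ferrers property the sets of non-neighbours form a chain, so their sizes [f] rank the left
   side. As [idx] stays below [n], the factor [n.+1] makes [idx] a mere tie-breaker. *)
pose n := #|V|; pose f x := #|[pred t | ~~ M x t]|.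
pose idx x := #|[pred y | lt y x]|.
have idx_lt v x : lt v x -> idx v < idx x.
  move=> vx; apply/proper_card/properP; split.
    by apply/fintype.subsetP => y; rewrite !inE => /lttr; apply.
  by exists v; rewrite !inE // ltxx.
have idxn x : idx x < n.
  rewrite /n -(cardC [pred y | lt y x]) -addn1 leq_add2l.
  by apply/card_gt0P; exists x; rewrite !inE ltxx.
exists (fun x => f x * n.+1 + idx x).
exists (fun s => (\max_(y | M y s) f y) * n.+1 + n).
split=> [x s|v x vx le_xv].
  case: ifPn => Mxs.
    have : f x <= \max_(y | M y s) f y by apply: leq_bigmax_cond.
    by have := idxn x; nia.
  suff : \max_(y | M y s) f y < f x by nia.
  (* Positivity covers an [s] related to no [y], whose empty maximum is 0. *)
  have f_gt0 : 0 < f x by apply/card_gt0P; exists s; rewrite inE.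
  rewrite -(prednK f_gt0) ltnS; apply/bigmax_leqP => y Mys.
  rewrite -ltnS (prednK f_gt0); apply/proper_card/properP; split.
    apply/fintype.subsetP => t; rewrite !inE; apply: contra => Mxt.
    by have := ferrers Mxt Mys; rewrite (negPf Mxs).
  by exists s; rewrite !inE ?negbK.
have lt_f : f x < f v by have := idx_lt _ _ vx; have := idxn v; nia.
have /fintype.subsetPn[t] : ~~ ([pred t | ~~ M v t] \subset [pred t | ~~ M x t]).
  by apply: contraL lt_f => /subset_leq_card; rewrite -leqNgt.
by rewrite !inE negbK; exists t.
Qed.

End Rank.

(** * Pattern avoidance and the Ferrers property *)

Section Patterns.
Variables (V : finType) (E lt : rel V).
Hypothesis lt_slo : strict_linear_order lt.

(** A violation forces t < x and s < y with tx and sy non-arcs. Having both x <= s and y <= t would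
    close a cycle; exactly one of them gives (a). Otherwise s and t both precede x and y, and the
    orders within the two pairs decide between (b) and (c). *)
Lemma patterns_abc_ferrers :
  ~ pattern_a E lt -> ~ pattern_b E lt -> ~ pattern_c E lt ->
  forall x y s t, weak lt x s || E s x -> weak lt y t || E t y ->
  (weak lt x t || E t x) || (weak lt y s || E s y).
Proof.
move=> Na Nb Nc x y s t.
case: (boolP (weak lt x t)) => //; case: (boolP (weak lt y s)) => /=.
  by rewrite orbT.
rewrite !(weakN lt_slo) => sy tx Msx Mty.
apply: contraT => /norP[NEtx NEsy]; exfalso.
have [xs|] := boolP (weak lt x s).
  case/orP: Mty => [yt|Ety].
    have ys := weak_lt_trans lt_slo yt (lt_weak_trans lt_slo tx xs).
    by have := weakN lt_slo y s; rewrite /weak ys sy orbT.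
  by apply: Na; exists t, x, s, y; rewrite tx xs sy Ety NEtx NEsy.
have [yt|] := boolP (weak lt y t).
  case/orP: Msx => [->//|Esx] _.
  by apply: Na; exists s, y, t, x; rewrite tx yt sy Esx NEtx NEsy.
rewrite !(weakN lt_slo) => ty sx.
move: Msx Mty; rewrite -[weak lt x s]negbK -[weak lt y t]negbK !(weakN lt_slo).
rewrite sx ty /= => Esx Ety.
case: lt_slo => _ _ lttot.
have nst : s != t by apply: contraNneq NEtx => <-.
have nxy : x != y by apply: contraNneq NEsy => <-.
case/orP: (lttot _ _ nst) => [st|ts]; case/orP: (lttot _ _ nxy) => [xy|yx].
- by apply: Nc; exists s, t, x, y; rewrite st tx xy Esx Ety NEsy NEtx.
- by apply: Nb; exists s, t, y, x; rewrite /weak st ty yx Esx Ety NEsy NEtx orbT.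
- by apply: Nb; exists t, s, x, y; rewrite /weak ts sx xy Esx Ety NEsy NEtx orbT.
- by apply: Nc; exists t, s, y, x; rewrite ts sy yx Esx Ety NEsy NEtx.
Qed.

(** The quadruple is read backwards while the arcs stay unchanged; likewise for the next two
    lemmas. *)
Lemma pattern_a_rev : pattern_a E (fun x y => lt y x) -> pattern_d E lt.
Proof.
move=> [u [v [w [z]]]]; rewrite weak_rev => /and5P[uv vw wz Euz].
by case/andP=> *; exists z, w, v, u; apply/and5P; split=> //; apply/andP.
Qed.

Lemma pattern_b_rev : pattern_b E (fun x y => lt y x) -> pattern_e E lt.
Proof.
move=> [u [v [w [z]]]]; rewrite weak_rev => /and5P[uv vw wz Euz].
by case/and3P=> *; exists z, w, v, u; apply/and5P; split=> //; apply/and3P.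
Qed.

Lemma pattern_c_rev : pattern_c E (fun x y => lt y x) -> pattern_f E lt.
Proof.
move=> [u [v [w [z]]]] => /and5P[uv vw wz Euz].
by case/and3P=> *; exists z, w, v, u; apply/and5P; split=> //; apply/and3P.
Qed.

End Patterns.

(** * Intervals as endpoint inequalities *)

Local Open Scope ring_scope.

Definition nest_endpoints (R : realType) (V : finType) (E : rel V)
    (a b c d : V -> R) : Prop :=
  (forall u, [/\ a u <= c u, c u <= d u & d u <= b u]) /\
  (forall u v, E u v = (a u <= d v) && (c v <= b u)).

Lemma itv_meetP (R : realType) (a b c d : R) : a <= b -> c <= d ->
  (`[a, b] `&` `[c, d] !=set0)%classic <-> (a <= d) && (c <= b).
Proof.
move=> ab cd; split=> [[x []]|/andP[ad cb]].
  by rewrite /= !in_itv /= => /andP[? ?] /andP[? ?]; apply/andP; split; lra.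
exists (Num.max a c); rewrite /= !in_itv /=.
by rewrite !ge_max !le_max !lexx ab cd ad cb orbT.
Qed.

Lemma interval_nestP (R : realType) (V : finType) (E : rel V) :
  interval_nest R E <-> exists a b c d : V -> R, nest_endpoints E a b c d.
Proof.
split=> [[I [J [hI hJ JI EIJ]]]|[a [b [c [d [abcd Eabcd]]]]]].
  have [a /choice[b Iab]] := choice hI; have [c /choice[d Jcd]] := choice hJ.
  exists a, b, c, d; split=> [u|u v].
    have [ab defI] := Iab u; have [cd defJ] := Jcd u.
    have sub x : c u <= x <= d u -> a u <= x <= b u.
      by have := JI u x; rewrite defI defJ /= !in_itv /= => + Jx; apply.
    have /andP[? _] : a u <= c u <= b u by apply: sub; rewrite lexx.
    by have /andP[_ ?] : a u <= d u <= b u by apply: sub; rewrite lexx cd.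
  have [ab defI] := Iab u; have [cd defJ] := Jcd v.
  have EP := EIJ u v; rewrite defI defJ in EP.
  by have := itv_meetP ab cd; rewrite -EP => H; apply/idP/idP => /H.
exists (fun u => `[a u, b u]%classic), (fun u => `[c u, d u]%classic).
split=> [u|u|u x|u v].
- by exists (a u), (b u); have [? ? ?] := abcd u; split; first lra.
- by exists (c u), (d u); have [? ? ?] := abcd u; split; first lra.
- by have [? ? ?] := abcd u; rewrite /= !in_itv /= => /andP[? ?]; lra.
have [? ? ?] := abcd u; have [? ? ?] := abcd v.
by rewrite Eabcd; apply: iff_sym; apply: itv_meetP; lra.
Qed.

(** * From intervals to an ordering *)

Section Ordering.
Variables (R : realType) (V : finType) (f : V -> R).

Definition lex_rank_lt : rel V := fun u v =>
  (f u < f v) || (f u == f v) && (enum_rank u < enum_rank v)%N.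

Lemma lex_rank_ltP : strict_linear_order lex_rank_lt.
Proof.
rewrite /lex_rank_lt; split=> [u|v u w|u v nuv].
- by rewrite ltxx ltnn andbF.
- case/orP=> [uv|/andP[/eqP-> uv]]; case/orP=> [vw|/andP[/eqP<- vw]].
  + by rewrite (lt_trans uv vw).
  + by rewrite uv.
  + by rewrite vw.
  + by rewrite eqxx (ltn_trans uv vw) orbT.
have [//|//|_] := ltgtP (f u) (f v); rewrite /= -neq_ltn.
by apply: contra nuv => /eqP/val_inj/enum_rank_inj->.
Qed.

Lemma lex_rank_lt_le u v : lex_rank_lt u v -> f u <= f v.
Proof. by case/orP=> [/ltW//|/andP[/eqP-> _]]. Qed.

Lemma lex_rank_weak_le u v : weak lex_rank_lt u v -> f u <= f v.
Proof. by case/orP=> [/eqP->//|/lex_rank_lt_le]. Qed.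

End Ordering.

Lemma nest_endpoints_order (R : realType) (V : finType) (E : rel V)
    (a b c d : V -> R) : nest_endpoints E a b c d ->
  let lt := lex_rank_lt c in
  ~ pattern_a E lt /\ ~ pattern_b E lt /\ ~ pattern_c E lt /\
  ~ pattern_d E lt /\ ~ pattern_e E lt /\ ~ pattern_f E lt /\
  ~ pattern_g E lt /\ ~ pattern_h E lt /\ ~ pattern_j E.
Proof.
move=> [abcd Eabcd] lt.
have le u v : lt u v -> c u <= c v by apply: lex_rank_lt_le.
have wle u v : weak lt u v -> c u <= c v by apply: lex_rank_weak_le.
do ![split]; last first.
  by case=> u; rewrite Eabcd negb_and -!ltNge; have [? ? ?] := abcd u; lra.
all: move=> [u [v [w [z]]]]; rewrite !Eabcd !negb_and -!ltNge.
all: have [? ? ?] := abcd u; have [? ? ?] := abcd v.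
all: have [? ? ?] := abcd w; have [? ? ?] := abcd z.
all: case/and3P=> /le ? vw; have ? : c v <= c w by first [exact: le vw|exact: wle vw].
all: move=> /andP[/le ?]; clear abcd Eabcd le wle vw lt E.
(* The goals are in reverse order: these are (h), (g), (d), (a), with one arc each; the others have
   two. *)
1,2,5,8: by case/and3P=> /andP[? ?] /orP[?|?] /orP[?|?]; lra.
all: by case/and4P=> /andP[? ?] /andP[? ?] /orP[?|?] /orP[?|?]; lra.
Qed.

(** * From an ordering to intervals *)

Lemma order_nest_endpoints (R : realType) (V : finType) (E lt : rel V) :
  strict_linear_order lt ->
  ~ pattern_a E lt -> ~ pattern_b E lt -> ~ pattern_c E lt ->
  ~ pattern_d E lt -> ~ pattern_e E lt -> ~ pattern_f E lt ->
  ~ pattern_g E lt -> ~ pattern_h E lt -> ~ pattern_j E ->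
  exists a b c d : V -> R, nest_endpoints E a b c d.
Proof.
move=> slo Na Nb Nc Nd Ne Nf Ng Nh Nj.
have [ga [be [Mcb cb_tie]]] := ferrers_rank slo (patterns_abc_ferrers slo Na Nb Nc).
have rslo := strict_linear_order_rev slo.
(* Reflecting the line turns d and a into the left and right values of the reversed order. *)
have [de' [al' []]] := ferrers_rank rslo
  (patterns_abc_ferrers rslo (fun p => Nd (pattern_a_rev p))
     (fun p => Ne (pattern_b_rev p)) (fun p => Nf (pattern_c_rev p))).
(* Subtraction from the common bound [K] undoes the reflection without truncation. *)
pose K := (\max_v al' v + \max_v de' v)%N.
have alK x : (al' x <= K)%N by apply: leq_trans (leq_addr _ _); apply: leq_bigmax.
have deK x : (de' x <= K)%N by apply: leq_trans (leq_addl _ _); apply: leq_bigmax.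
pose al x := (K - al' x)%N; pose de x := (K - de' x)%N => Mad' ad_tie'.
have Mad x s : if weak lt x s || E x s then (al x < de s)%N else (de s < al x)%N.
  have := Mad' s x; rewrite weak_rev /al /de.
  by have := alK x; have := deK s; case: ifP => _; lia.
have ad_tie s w : lt s w -> (de w <= de s)%N ->
    exists2 x, weak lt x s || E x s & ~~ (weak lt x w || E x w).
  move=> sw le_ws; have [|x] := ad_tie' w s sw.
    by move: le_ws; rewrite /de; have := deK s; have := deK w; lia.
  by rewrite !(weak_rev lt); exists x.
(* A rank m among the a's and d's becomes the value p m, which is at least exactly
   those c's and b's whose rank is less than g m. *)
pose below m := [pred v | [exists w, weak lt v w && (de w <= m)%N]].
pose g m := (\max_(v in below m) (ga v).+1)%N.
have g_mono m n : (m <= n)%N -> (g m <= g n)%N.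
  move=> mn; apply/bigmax_leqP => v /existsP[w /andP[vw wm]].
  apply: (@leq_bigmax_cond _ _ (fun v => (ga v).+1)).
  by apply/existsP; exists w; rewrite vw (leq_trans wm).
(* The c's and b's will sit at multiples of [N]; a rank m <= [K] is too small to carry [p m] to the
   next multiple. *)
pose N := K.+1.
pose p m := (g m * N + m)%N.
have p_le : {mono p : m n / (m <= n)%N}.
  apply: leq_mono => m n mn; rewrite /p -addnS leq_add //.
  by rewrite leq_mul2r g_mono ?orbT // ltnW.
have p_le_mul q m : (g m <= q)%N -> (m <= K)%N -> (p m <= q.+1 * N)%N.
  by move=> gmq mK; rewrite /p mulSn addnC leq_add ?leqW // leq_mul2r gmq orbT.
exists (fun x => (p (al x))%:R), (fun x => ((be x).+1 * N)%:R).
exists (fun x => ((ga x).+1 * N)%:R), (fun x => (p (de x))%:R).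
split=> [u|u v]; rewrite !ler_nat.
  split.
  (* For a_u <= c_u, a bad pair v <= w has w < u with uw a non-arc, and the tie-break between v and
     u supplies the first vertex t of pattern (g). *)
  - apply: p_le_mul (leq_subr _ _).
    apply/bigmax_leqP => v /existsP[w /andP[vw wu]]; rewrite ltnNge; apply/negP => gauv.
    have := Mad u w; case: ifPn => [_|]; first by rewrite ltnNge wu.
    rewrite negb_or (weakN slo) => /andP[wu' NEuw] _.
    have vu := weak_lt_trans slo vw wu'.
    have [t Mut] := cb_tie _ _ vu gauv.
    rewrite negb_or (weakN slo) => /andP[tv NEtv].
    have tu : ~~ weak lt u t.
      by rewrite (weakN slo); case: slo => _ lttr _; apply: lttr tv vu.
    move: Mut; rewrite (negPf tu) /= => Etu.
    by apply: Ng; exists t, v, w, u; rewrite tv vw wu' Etu NEtv NEuw.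
  - apply: leq_trans (leq_addr _ _); rewrite leq_mul2r; apply/orP; right.
    apply: (@leq_bigmax_cond _ _ (fun v => (ga v).+1)).
    by apply/existsP; exists u; rewrite /weak eqxx leqnn.
  (* Dually for d_u <= b_u: the tie-break between u and w supplies the last vertex x of pattern
     (h). *)
  - apply: p_le_mul (leq_subr _ _).
    apply/bigmax_leqP => v /existsP[w /andP[vw wu]].
    have := Mcb v u; case: ifPn => // + _.
    rewrite negb_or (weakN slo) => /andP[uv NEuv].
    have uw := lt_weak_trans slo uv vw.
    have [x Mxu] := ad_tie _ _ uw wu.
    rewrite negb_or (weakN slo) => /andP[wx NExw].
    have ux : ~~ weak lt x u.
      by rewrite (weakN slo); case: slo => _ lttr _; apply: lttr uw wx.
    move: Mxu; rewrite (negPf ux) /= => Exu.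
    by case: Nh; exists u, v, w, x; rewrite uv vw wx Exu NEuv NExw.
rewrite p_le leq_pmul2r // ltnS.
have -> : (al u <= de v)%N = weak lt u v || E u v by have := Mad u v; case: ifP => _; lia.
have -> : (ga v <= be u)%N = weak lt v u || E u v by have := Mcb v u; case: ifP => _; lia.
(* Loops exist by (j); for distinct vertices the two order conditions exclude each other, leaving
   the arc. *)
have [uv|] := eqVneq u v.
  by rewrite -uv; case: (boolP (E u u)) => [|?]; [rewrite !orbT | case: Nj; exists u].
move=> nuv; rewrite -orb_andl.
suff -> : weak lt u v && weak lt v u = false by [].
rewrite -[weak lt v u]negbK (weakN slo) /weak (negPf nuv) /=.
by rewrite andbN.
Qed.

Theorem theorem2 (R : realType) (V : finType) (E : rel V) :
  interval_nest R E <->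
  exists lt : rel V, strict_linear_order lt /\
    ~ pattern_a E lt /\ ~ pattern_b E lt /\ ~ pattern_c E lt /\
    ~ pattern_d E lt /\ ~ pattern_e E lt /\ ~ pattern_f E lt /\
    ~ pattern_g E lt /\ ~ pattern_h E lt /\ ~ pattern_j E.
Proof.
rewrite interval_nestP; split=> [[a [b [c [d /nest_endpoints_order Nlt]]]]|].
  by exists (lex_rank_lt c); split=> //; apply: lex_rank_ltP.
by case=> lt [slo [? [? [? [? [? [? [? [? ?]]]]]]]]]; apply: order_nest_endpoints slo _ _ _ _ _ _ _ _ _.
Qed.
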